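(* Let $f=(f_1,f_2,\dots,f_m)$ where each $f_j\in C_0^\infty(\mathbb R^n)$, $1\le j\le m$, is real-valued. Then $$\int_{\mathbb R^n}|\nabla f(x)|^2\, dx\int_{\mathbb R^n}|x|^{2}|f(x)|^{2}\,dx\;\geq\; \frac{n^2}{4}\left(\int_{\mathbb R^n}|f(x)|^2\,dx\right)^2 +\mathrm{COV}^2,$$ where $$\mathrm{COV} = \int_{\mathbb R^n}|f(x)|^{2}\,|x|\,|\Phi_f'(x)|\,dx .$$
   Context: $C_0^\infty(\mathbb R^n)$ denotes the smooth functions with compact support in $\mathbb R^n$. For vector-valued $f=(f_1,\dots,f_m)$: $|f(x)|^2=\sum_{j=1}^m f_j(x)^2$ and $|\nabla f(x)|^2=\sum_{k=1}^n\sum_{j=1}^m|\partial_k f_j(x)|^2$. Generalized phase derivative: at points where $f(x)\ne 0$, $$|\Phi_f'(x)|=\left(\sum_{k=1}^n\sum_{1\leq j<l\leq m}\left(\frac{f_l(x)}{|f(x)|^2}\partial_k f_j(x)-\frac{f_j(x)}{|f(x)|^2}\partial_k f_l(x)\right)^2\right)^{1/2}.$$ Integrands containing the product of a positive power of $|f(x)|$ with $|\Phi_f'(x)|$ are taken to be $0$ at points where $f(x)=0$. *)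

(* Defs.v *)
From HB Require Import structures.
From mathcomp Require Import all_boot all_order all_algebra.
From mathcomp Require Import all_classical all_reals all_analysis.
From mathcomp Require Import measurable_realfun.
Import Order.TTheory GRing.Theory Num.Theory.
Import numFieldNormedType.Exports.

Set Implicit Arguments.
Unset Strict Implicit.
Unset Printing Implicit Defensive.

Local Open Scope classical_set_scope.
Local Open Scope ring_scope.

Definition borel_rV_display : measure_display.
Proof. exact: default_measure_display. Qed.

(* The topology of 'rV[R]_n comes from the sup norm; its Borel sets are those
   of the Euclidean topology. *)
Section rV_borel.
Context (R : realType) (n : nat).

Definition borel_rV : set (set 'rV[R]_n) := <<s open >>.

Let borel0 : borel_rV set0.
Proof. exact: sigma_algebra0. Qed.

Let borelC A : borel_rV A -> borel_rV (~` A).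
Proof. exact: sigma_algebraC. Qed.

Let borel_bigcup (F : (set 'rV[R]_n)^nat) :
  (forall i, borel_rV (F i)) -> borel_rV (\bigcup_i (F i)).
Proof. exact: sigma_algebra_bigcup. Qed.

HB.instance Definition _ := @isMeasurable.Build borel_rV_display
  'rV[R]_n borel_rV borel0 borelC borel_bigcup.

End rV_borel.

Section rV_measurable.
Context (R : realType).
Local Notation RB := (measurableTypeR R).

Lemma measurable_open_rV n (U : set 'rV[R]_n) : open U -> measurable U.
Proof. exact: sub_sigma_algebra. Qed.

Lemma measurable_coord_rV n (i : 'I_n) :
  measurable_fun [set: 'rV[R]_n] (fun x => x 0 i : RB).
Proof.
apply: (measurability _ (RGenOpens.measurableE R)).
move=> _ [_ [a [b ->]] <-]; rewrite setTI; apply: measurable_open_rV.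
apply: open_comp; last exact: interval_open.
by move=> x _; exact: coord_continuous.
Qed.

Lemma open_rV_rat_boxes n (U : set 'rV[R]_n) : open U ->
  U = \bigcup_(p in [set p : 'rV[rat]_n * 'rV[rat]_n |
        [set y : 'rV[R]_n | forall i, y 0 i \in `]ratr (p.1 0 i), ratr (p.2 0 i)[]
          `<=` U])
      [set y : 'rV[R]_n | forall i, y 0 i \in `]ratr (p.1 0 i), ratr (p.2 0 i)[].
Proof.
move=> oU; apply/seteqP; split => [x Ux|x [p pU /pU]//].
have /nbhs_ballP[e /= e0 xeU] : nbhs x U by apply: open_nbhs_nbhs.
have Ha i : exists q, ratr q \in `](x 0 i - e), (x 0 i)[.
  by apply: rat_in_itvoo; rewrite ltrBlDr ltrDl.
have Hb i : exists q, ratr q \in `](x 0 i), (x 0 i + e)[.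
  by apply: rat_in_itvoo; rewrite ltrDl.
have [a aP] := choice Ha; have [b bP] := choice Hb.
exists (\row_i a i, \row_i b i) => /= [y yab|i].
  apply: xeU; split => // i j; rewrite ord1 /ball/=.
  have := yab j; rewrite !mxE; move: (aP j) (bP j); rewrite !in_itv/=.
  move=> /andP[a1 a2] /andP[b1 b2] /andP[y1 y2].
  rewrite ltr_distlC; apply/andP; split.
    exact: lt_trans a1 y1.
  exact: lt_trans y2 b2.
rewrite !mxE; move: (aP i) (bP i); rewrite !in_itv/=.
by move=> /andP[_ ->] /andP[->].
Qed.

Lemma measurable_fun_rV d (T : measurableType d) n (f : T -> 'rV[R]_n) :
  (forall i, measurable_fun [set: T] (fun t => f t 0 i : RB)) ->
  measurable_fun [set: T] f.
Proof.
move=> mf; apply: (@measurability _ _ _ _ _ _ (@open 'rV[R]_n)) => //.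
move=> _ [U oU <-]; rewrite setTI (open_rV_rat_boxes oU) preimage_bigcup.
rewrite bigcup_mkcond; apply: countable_bigcupT_measurable => [|p]; first exact: countableP.
case: ifPn => // _.
rewrite (_ : _ @^-1` _ = \bigcap_(i in [set: 'I_n])
    (fun t => f t 0 i : RB) @^-1`
      [set` `]ratr (p.1 0 i) : R, ratr (p.2 0 i)[]); last first.
  by apply/seteqP; split => [t tp i _|t tp i] /=; [exact: tp|exact: (tp i I)].
apply: fin_bigcap_measurable => [|i _]; first exact: finite_finset.
by rewrite -[X in measurable X]setTI; apply: mf => //; exact: measurable_itv.
Qed.

(* (t, x_1, ..., x_n) from (t, x); 'rV_(1 + n) is convertible to 'rV_n.+1. *)
Definition rV_cons n (p : RB * 'rV[R]_n) : 'rV[R]_n.+1 :=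
  row_mx (p.1)%:M p.2 : 'rV[R]_(1 + n).

Definition rV_uncons n (x : 'rV[R]_n.+1) : RB * 'rV[R]_n :=
  (x 0 0, rsubmx (x : 'rV[R]_(1 + n))).

Lemma rV_cons0 n p : @rV_cons n p 0 0 = p.1.
Proof.
have e : lshift n (0 : 'I_1) = 0 :> 'I_(1 + n) by exact/val_inj.
have := @row_mxEl R 1 1 n (p.1)%:M p.2 0 0.
by rewrite e [RHS]mxE eqxx mulr1n.
Qed.

Lemma rV_consS n p (i : 'I_n) : rV_cons p 0 (lift ord0 i) = p.2 0 i.
Proof.
have e : rshift 1 i = lift ord0 i :> 'I_(1 + n) by exact/val_inj.
have := @row_mxEr R 1 1 n (p.1)%:M p.2 0 i.
by rewrite e.
Qed.

Lemma rV_consK n : cancel (@rV_cons n) (@rV_uncons n).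
Proof.
by case=> t x; rewrite /rV_uncons rV_cons0 /rV_cons row_mxKr.
Qed.

Lemma rV_unconsK n : cancel (@rV_uncons n) (@rV_cons n).
Proof.
move=> x; apply/rowP => i; case: (unliftP ord0 i) => [j ->|->].
  by rewrite rV_consS mxE; congr (x _ _); exact/val_inj.
by rewrite rV_cons0.
Qed.

Lemma measurable_rV_cons n : measurable_fun setT (@rV_cons n).
Proof.
apply: measurable_fun_rV => i; case: (unliftP ord0 i) => [j ->|->].
  under eq_fun do rewrite rV_consS.
  exact: (measurableT_comp (measurable_coord_rV j) measurable_snd).
under eq_fun do rewrite rV_cons0.
exact: measurable_fst.
Qed.

Lemma measurable_rV_uncons n : measurable_fun setT (@rV_uncons n).
Proof.
apply/measurable_fun_pairP; split; first exact: measurable_coord_rV.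
apply: measurable_fun_rV => i.
rewrite (_ : (fun _ => _) = (fun x : 'rV[R]_n.+1 => x 0 (lift ord0 i) : RB)).
  exact: measurable_coord_rV.
by apply/funext => x; rewrite /= mxE; congr (x _ _); exact/val_inj.
Qed.

End rV_measurable.

Section lebesgue_rV.
Local Open Scope ereal_scope.
Context (R : realType).

Section step.
Context (n : nat) (mu : {sigma_finite_measure set 'rV[R]_n -> \bar R}).

Definition lebesgue_rV_step : set 'rV[R]_n.+1 -> \bar R :=
  pushforward (@lebesgue_measure R \x mu) (@rV_cons R n).

Let mcons := @measurable_rV_cons R n.

Let step0 : lebesgue_rV_step set0 = 0.
Proof. by rewrite /lebesgue_rV_step /pushforward preimage_set0 measure0. Qed.

Let step_ge0 A : 0 <= lebesgue_rV_step A.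
Proof. exact: measure_ge0. Qed.

Let step_sigma_additive : semi_sigma_additive lebesgue_rV_step.
Proof.
exact: (@measure_semi_sigma_additive _ _ _
  (pushforward (@lebesgue_measure R \x mu) (@rV_cons R n))).
Qed.

HB.instance Definition _ := isMeasure.Build _ _ _ lebesgue_rV_step
  step0 step_ge0 step_sigma_additive.

Let step_sigma_finite : sigma_finite setT lebesgue_rV_step.
Proof.
have /sigma_finiteP[F [TF ndF Foo]] := sigma_finiteT (@lebesgue_measure R).
have /sigma_finiteP[G [TG ndG Goo]] := sigma_finiteT mu.
exists (fun k => @rV_uncons R n @^-1` (F k `*` G k)).
  rewrite -preimage_bigcup (_ : \bigcup_k _ = setT) ?preimage_setT//.
  apply/seteqP; split => // -[x y] _.
  have : [set: measurableTypeR R] x by [].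
  have : [set: 'rV[R]_n] y by [].
  rewrite TF TG => -[k _ Gky] [l _ Flx]; exists (maxn l k) => //; split => /=.
  - by move: x Flx; exact/subsetPset/ndF/leq_maxl.
  - by move: y Gky; exact/subsetPset/ndG/leq_maxr.
move=> k; have [mF Fk] := Foo k; have [mG Gk] := Goo k; split.
  rewrite -[X in measurable X]setTI; apply: measurable_rV_uncons => //.
  exact: measurableX.
rewrite /lebesgue_rV_step /pushforward -comp_preimage.
rewrite (_ : _ \o _ = id) ?preimage_id; last first.
  by apply/funext => p; exact: rV_consK.
by rewrite product_measure1E// lte_mul_pinfty// ge0_fin_numE.
Qed.

HB.instance Definition _ := Measure_isSigmaFinite.Build _ _ _ lebesgue_rV_step
  step_sigma_finite.

End step.

(* Lebesgue measure on R^n, restricted to the Borel sets: the n-fold product of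
   the one-dimensional Lebesgue measure. *)
Fixpoint lebesgue_rV (n : nat) : {sigma_finite_measure set 'rV[R]_n -> \bar R} :=
  match n with
  | 0 => \d_(0%R : 'rV[R]_0)
  | n'.+1 => lebesgue_rV_step (lebesgue_rV n')
  end.

Lemma lebesgue_rV_box n (A : 'I_n -> set (measurableTypeR R)) :
  (forall i, measurable (A i)) ->
  lebesgue_rV n [set x | forall i, A i (x 0%R i)] =
  \prod_(i < n) lebesgue_measure (A i).
Proof.
elim: n A => [A _|n IH A mA].
  by rewrite big_ord0 /= diracE mem_set// => -[].
pose B := [set x : 'rV[R]_n | forall i, A (lift ord0 i) (x 0%R i)].
have mB : measurable B.
  rewrite (_ : B = \bigcap_(i in [set: 'I_n])
      ((fun x : 'rV[R]_n => x 0%R i : measurableTypeR R) @^-1` A (lift ord0 i))).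
    apply: fin_bigcap_measurable => [|i _]; first exact: finite_finset.
    by rewrite -[X in measurable X]setTI; exact: measurable_coord_rV.
  by apply/seteqP; split => [x xA i _|x xA i]; [exact: xA|exact: (xA i I)].
rewrite big_ord_recl -(IH (fun i => A (lift ord0 i))) => [|i]; last exact: mA.
rewrite -/B [LHS]/= /lebesgue_rV_step /pushforward -product_measure1E//.
congr (_ _); apply/seteqP; split => [p pA|p [p1 p2] i] /=.
  split => [|i]; first by have := pA ord0; rewrite rV_cons0.
  by have := pA (lift ord0 i); rewrite rV_consS.
by case: (unliftP ord0 i) => [j ->|->]; rewrite ?rV_consS ?rV_cons0.
Qed.

End lebesgue_rV.

Section smooth.
Context (R : realType) (n : nat).
Implicit Type g : 'rV[R]_n -> R.

Definition partial (k : 'I_n) g : 'rV[R]_n -> R :=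
  fun x => 'D_(delta_mx 0 k) g x.

Definition iter_partial (s : seq 'I_n) g : 'rV[R]_n -> R := foldr partial g s.

(* C^oo: all iterated partial derivatives exist and are continuous; the
   derivability clause is needed because 'D_ is a total function. *)
Definition smooth g : Prop := forall s : seq 'I_n,
  continuous (iter_partial s g) /\
  forall (k : 'I_n) (x : 'rV[R]_n), derivable (iter_partial s g) x (delta_mx 0 k).

Definition supp g : set 'rV[R]_n := closure [set x | g x != 0].

Definition smooth_compact_supp g : Prop := smooth g /\ compact (supp g).

End smooth.

(* Euclidean norm; the library norm of 'rV[R]_n is the sup norm. *)
Definition enorm (R : realType) (n : nat) (x : 'rV[R]_n) : R :=
  Num.sqrt (\sum_(i < n) (x 0 i) ^+ 2).

Section vector_valued.
Context (R : realType) (n m : nat).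
Implicit Types (f : 'I_m -> 'rV[R]_n -> R) (x : 'rV[R]_n).

Definition vnorm f x : R := Num.sqrt (\sum_(j < m) (f j x) ^+ 2).

Definition grad_norm f x : R :=
  Num.sqrt (\sum_(k < n) \sum_(j < m) `|partial k (f j) x| ^+ 2).

(* Where f x = 0 the divisions by 0 make this 0, so an integrand having a
   positive power of vnorm f x as a factor is 0 there. *)
Definition phase_deriv f x : R :=
  Num.sqrt (\sum_(k < n) \sum_(j < m) \sum_(l < m | (j < l)%N)
    (f l x / vnorm f x ^+ 2 * partial k (f j) x
     - f j x / vnorm f x ^+ 2 * partial k (f l) x) ^+ 2).

Definition COV f : \bar R :=
  (\int[lebesgue_rV R n]_x (vnorm f x ^+ 2 * enorm x * phase_deriv f x)%:E)%E.

End vector_valued.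

(* Main.v *)
Require Import Defs.
From HB Require Import structures.
From mathcomp Require Import all_boot all_order all_algebra.
From mathcomp Require Import all_classical all_reals all_analysis.
From mathcomp Require Import measurable_realfun ring lra.
Import Order.TTheory GRing.Theory Num.Theory.
Import numFieldNormedType.Exports.

Local Open Scope classical_set_scope.
Local Open Scope ring_scope.

Set Implicit Arguments.
Unset Strict Implicit.
Unset Printing Implicit Defensive.

(** Where f does not vanish, Lagrange's identity, applied for each k to the
    vectors f and d_k f, splits the gradient orthogonally:
      |grad f|^2 = |grad |f||^2 + (|f| |Phi'_f|)^2,
    where d_k |f| = (f . d_k f) / |f|. Where f vanishes both terms on the right
    are 0, so the sum is at most |grad f|^2 everywhere ([sqr_grad_norm_ge]).
    Multiplying the integral of |grad f|^2 by that of (|x| |f|)^2 and applying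
    the Cauchy-Schwarz inequality to each of the two parts bounds the product
    from below by
      (int |x| |f| |grad |f||)^2 + (int |x| |f| |f| |Phi'_f|)^2.
    The second square is COV^2, with equality. In the first one,
    |x| |f| |grad |f|| dominates |x . grad (|f|^2)| / 2, and integrating
    x . grad g by parts gives -n times the integral of g = |f|^2
    ([integral_euler]), hence the constant n^2 / 4 ([integral_radial_ge]).

    The integration by parts rests on [integral_partial_eq0]: a partial
    derivative of a compactly supported C^1 function has integral 0. Lebesgue
    measure on R^(n+1) is by construction the image of a product measure on
    R * R^n, so this is an induction on n: Fubini's theorem integrates first
    over the variable of derivation if it is the first one, where the
    fundamental theorem of calculus applies, and over the other n variables
    otherwise, where the induction hypothesis applies.

    Both Cauchy-Schwarz inequalities and the recombination of the two parts are
    carried out between integrals of nonnegative functions in [0, +oo]. The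
    integration by parts takes place between integrable functions: continuous
    ones vanishing outside a box ([integrable_vanishes_off_box]). *)

(** * The identity of Lagrange and the Cauchy-Schwarz inequality *)

Lemma lagrange_identity (R : comPzRingType) (m : nat) (a b : 'I_m -> R) :
  (\sum_j a j ^+ 2) * (\sum_j b j ^+ 2) =
  (\sum_j a j * b j) ^+ 2 +
  \sum_(j < m) \sum_(l < m | (j < l)%N) (a l * b j - a j * b l) ^+ 2.
Proof.
elim: m a b => [|m IH] a b; first by rewrite !big_ord0; ring.
(* Pairs j < l of 'I_m.+1 either avoid the last index or have it as l. *)
have split (F : 'I_m.+1 -> 'I_m.+1 -> R) :
    \sum_(j < m.+1) \sum_(l < m.+1 | (j < l)%N) F j l =
    (\sum_(j < m) \sum_(l < m | (j < l)%N)
      F (widen_ord (leqnSn m) j) (widen_ord (leqnSn m) l)) +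
    \sum_(j < m) F (widen_ord (leqnSn m) j) ord_max.
  rewrite big_ord_recr /= [X in _ + X]big_pred0 ?addr0; last first.
    by move=> l /=; rewrite ltnNge -ltnS ltn_ord.
  rewrite -big_split; apply: eq_bigr => j _ /=.
  by rewrite big_mkcond big_ord_recr /= ltn_ord -big_mkcond.
rewrite split !big_ord_recr /=.
have := IH (fun i => a (widen_ord (leqnSn m) i)) (fun i => b (widen_ord (leqnSn m) i)).
set A := \sum_(i < m) a _ ^+ 2; set B := \sum_(i < m) b _ ^+ 2.
set C := \sum_(i < m) a _ * b _; set D := \sum_(i < m) \sum_(l < m | _) _.
set x := a ord_max; set y := b ord_max => IHm.
have -> : \sum_(j < m) (x * b (widen_ord (leqnSn m) j) -
    a (widen_ord (leqnSn m) j) * y) ^+ 2 = x ^+ 2 * B + y ^+ 2 * A - x * y * C *+ 2.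
  rewrite /A /B /C !mulr_sumr -sumrMnl -big_split -sumrB /=.
  by apply: eq_bigr => j _; ring.
rewrite mulrDl !mulrDr IHm; ring.
Qed.

Lemma cauchy_schwarz_sum (R : rcfType) (m : nat) (a b : 'I_m -> R) :
  `|\sum_j a j * b j| <=
  Num.sqrt (\sum_j a j ^+ 2) * Num.sqrt (\sum_j b j ^+ 2).
Proof.
rewrite -sqrtrM; last by apply: sumr_ge0 => j _; exact: sqr_ge0.
rewrite lagrange_identity -sqrtr_sqr ler_wsqrtr// lerDl.
by apply: sumr_ge0 => j _; apply: sumr_ge0 => l _; exact: sqr_ge0.
Qed.

(** Squares and products of extended reals take the place of L2 norms: either side
    may be infinite. *)
Lemma ge0_integral_cauchy_schwarz d (T : measurableType d) (R : realType)
    (mu : {measure set T -> \bar R}) (f g : T -> R) :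
  measurable_fun setT f -> measurable_fun setT g ->
  (forall x, 0 <= f x) -> (forall x, 0 <= g x) ->
  ((\int[mu]_x (f x * g x)%:E) ^+ 2 <=
   (\int[mu]_x (f x ^+ 2)%:E) * (\int[mu]_x (g x ^+ 2)%:E))%E.
Proof.
move=> mf mg f0 g0.
have half : (2^-1 + 2^-1 = 1 :> R)%R by lra.
have /= := hoelder mu mf mg (ltr0n _ 2) (ltr0n _ 2) half.
have L2 (h : T -> R) : (forall x, 0 <= h x) ->
    ((Lnorm mu 2%:E (EFin \o h)) ^+ 2 = \int[mu]_x (h x ^+ 2)%:E)%E.
  move=> h0; have L0 := Lnorm_ge0 mu 2%:E (EFin \o h).
  rewrite expe2 -[X in (X * X)%E](poweRe1 L0) -poweRD; last first.
    by apply: add_neq0_poweRD_def; rewrite -[(1 + 1)%R]/(2%:R) pnatr_eq0.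
  rewrite -[(1 + 1)%R]/(2%:R) poweR_Lnorm ?pnatr_eq0//.
  by apply: eq_integral => x _; rewrite /= powR_mulrn ?normr_ge0// ger0_norm.
have L1 : Lnorm mu 1 (EFin \o (f \* g)) = (\int[mu]_x (f x * g x)%:E)%E.
  rewrite Lnorm1; apply: eq_integral => x _ /=.
  by rewrite ger0_norm// mulr_ge0.
rewrite L1 -(L2 f f0) -(L2 g g0) => fg.
rewrite !expe2 muleACA; apply: lee_pmul => //; apply: integral_ge0 => x _;
  by rewrite lee_fin mulr_ge0.
Qed.

(** * Continuous functions vanishing outside a box *)

Lemma continuous_measurable_rV (R : realType) (n : nat)
    (h : 'rV[R]_n -> measurableTypeR R) :
  continuous (h : 'rV[R]_n -> R) -> measurable_fun setT h.
Proof.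
move=> ch; apply: (measurability _ (RGenOpens.measurableE R)).
move=> _ [_ [a [b ->]] <-]; rewrite setTI; apply: measurable_open_rV.
apply: open_comp; last exact: interval_open.
by move=> x _; exact: ch.
Qed.

(** Compact support in terms of coordinates: unlike the support itself, this form
    passes at once to the slices of [h] with the same [M]. *)
Definition vanishes_off_box (R : realType) (n : nat) (M : R)
    (h : 'rV[R]_n -> R) :=
  forall (x : 'rV[R]_n) (i : 'I_n), M < `|x 0 i| -> h x = 0.

Lemma supp_vanishes_off_box (R : realType) (n : nat) (h : 'rV[R]_n -> R) :
  compact (supp h) -> exists M, vanishes_off_box M h.
Proof.
move=> /compact_bounded[M0 [_ hM]]; exists (M0 + 1) => x i Mx.
apply: contrapT => /eqP hx.
have : `|x| <= M0 + 1.
  by apply: (hM (M0 + 1)); [rewrite ltrDl|apply: subset_closure; exact: hx].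
apply/negP; rewrite -ltNge (lt_le_trans Mx)// [leRHS]/Num.norm /= mx_normrE.
exact: (le_bigmax _ (fun ij : 'I_1 * 'I_n => `|x ij.1 ij.2|) (0, i)).
Qed.

(** The box is compact, so [h] is bounded on it, and it has finite measure. *)
Lemma integrable_vanishes_off_box (R : realType) (n : nat) (M : R)
    (h : 'rV[R]_n -> R) :
  continuous h -> vanishes_off_box M h ->
  (lebesgue_rV R n).-integrable setT (EFin \o h).
Proof.
move=> ch hM.
pose B := [set x : 'rV[R]_n | forall i, `[- M, M]%classic (x 0 i)].
have cB : compact B.
  by apply: (@rV_compact R n (fun=> `[- M, M]%classic)) => _; exact: segment_compact.
have mB : measurable B.
  rewrite -[B]setCK; apply: measurableC; apply: measurable_open_rV.
  by apply: closed_openC; apply: compact_closed => //; exact: norm_hausdorff.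
have [C [_ hC]] : bounded_set (h @` B).
  by apply/compact_bounded/continuous_compact => //; exact/continuous_subspaceT.
have h0 x : ~ B x -> h x = 0.
  move=> /existsNP[i] /negP; rewrite /= in_itv/= -ler_norml -ltNge.
  exact: hM.
have mh : measurable_fun setT (h : 'rV[R]_n -> measurableTypeR R).
  exact: continuous_measurable_rV.
apply/integrableP; split; first exact/measurable_EFinP.
apply: (@le_lt_trans _ _ (\int[lebesgue_rV R n]_(x in B) (cst (`|C| + 1)%:E) x)%E).
  rewrite [leRHS]integral_mkcond; apply: ge0_le_integral => //.
  - by apply/measurable_EFinP; exact: measurableT_comp.
  - by apply/(measurable_restrictT _ mB).
  - move=> x _ /=; rewrite patchE; case: ifPn => [/set_mem Bx|/negP Bx].
      rewrite lee_fin; apply: hC; last by exists x.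
      by rewrite (le_lt_trans (ler_norm C))// ltrDl.
    by rewrite h0 ?normr0// => ?; apply: Bx; exact/mem_set.
rewrite integral_cst// lte_mul_pinfty ?lee_fin ?addr_ge0//.
have /= -> // := @lebesgue_rV_box R n (fun=> `[- M, M]%classic).
rewrite ltey_eq; apply/orP; left; apply: prode_fin_num => i _.
by rewrite lebesgue_measure_itv; case: ifP.
Qed.

(** * Slices of a function of n + 1 variables *)

Lemma continuous_to_rV (R : realType) (T : topologicalType) (n : nat)
    (f : T -> 'rV[R]_n) :
  (forall i, continuous (fun t => f t 0 i)) -> continuous f.
Proof.
move=> cf t; apply/cvg_ballP => e e0.
have : \forall s \near t, forall i : 'I_n, ball (f t 0 i) e (f s 0 i).
  by apply: filter_forall => i; exact: (cvg_ball (cf i t)).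
by apply: filterS => s fs; split => // i j; rewrite ord1; exact: fs.
Qed.

Lemma continuous_rV_cons_l (R : realType) (n : nat) (y : 'rV[R]_n) :
  continuous (fun t : R => rV_cons (t, y)).
Proof.
apply: continuous_to_rV => i; case: (unliftP ord0 i) => [j ->|->].
  by under eq_fun do rewrite rV_consS; exact: cst_continuous.
by under eq_fun do rewrite rV_cons0; move=> x; exact: cvg_id.
Qed.

Lemma continuous_rV_cons_r (R : realType) (n : nat) (t : R) :
  continuous (fun y : 'rV[R]_n => rV_cons (t, y)).
Proof.
apply: continuous_to_rV => i; case: (unliftP ord0 i) => [j ->|->].
  by under eq_fun do rewrite rV_consS; exact: coord_continuous.
by under eq_fun do rewrite rV_cons0; exact: cst_continuous.
Qed.

(** This and the next lemma make the difference quotients of a slice equal to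
    those of the whole function, so that derivability and partial derivatives
    transfer without a chain rule. *)
Lemma rV_cons_shift_l (R : realType) (n : nat) (s t : R) (y : 'rV[R]_n) :
  rV_cons (s + t, y) = s *: delta_mx 0 0 + rV_cons (t, y).
Proof.
apply/rowP => i; rewrite [RHS]mxE [X in _ = X + _]mxE [X in _ = _ * X + _]mxE.
case: (unliftP ord0 i) => [j ->|->].
  by rewrite !rV_consS eqxx/= mulr0 add0r.
by rewrite !rV_cons0 !eqxx mulr1.
Qed.

Lemma rV_cons_shift_r (R : realType) (n : nat) (s t : R) (y : 'rV[R]_n) j :
  rV_cons (t, s *: delta_mx 0 j + y) =
  s *: delta_mx 0 (lift ord0 j) + rV_cons (t, y).
Proof.
apply/rowP => i; rewrite [RHS]mxE [X in _ = X + _]mxE [X in _ = _ * X + _]mxE.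
case: (unliftP ord0 i) => [l ->|->].
  by rewrite !rV_consS !mxE !eqxx/= (inj_eq lift_inj).
by rewrite !rV_cons0 !eqxx/= mulr0 add0r.
Qed.

Lemma derivable_rV_cons_l (R : realType) (n : nat) (h : 'rV[R]_n.+1 -> R) t y :
  (derivable (fun s => h (rV_cons (s, y))) t 1 <->
   derivable h (rV_cons (t, y)) (delta_mx 0 0)) /\
  'D_1 (fun s => h (rV_cons (s, y))) t = partial 0 h (rV_cons (t, y)).
Proof.
rewrite /partial /derive /derivable.
suff -> : (fun s => s^-1 *: (((fun s => h (rV_cons (s, y))) \o shift t) (s *: 1) -
    h (rV_cons (t, y)))) =
    (fun s => s^-1 *: ((h \o shift (rV_cons (t, y))) (s *: delta_mx 0 0) -
    h (rV_cons (t, y)))) by [].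
by apply/funext => s /=; rewrite rV_cons_shift_l [s *: 1]mulr1.
Qed.

Lemma derivable_rV_cons_r (R : realType) (n : nat) (h : 'rV[R]_n.+1 -> R) j t y :
  (derivable (fun z => h (rV_cons (t, z))) y (delta_mx 0 j) <->
   derivable h (rV_cons (t, y)) (delta_mx 0 (lift ord0 j))) /\
  partial j (fun z => h (rV_cons (t, z))) y =
  partial (lift ord0 j) h (rV_cons (t, y)).
Proof.
rewrite /partial /derive /derivable.
suff -> : (fun s => s^-1 *: (((fun z => h (rV_cons (t, z))) \o shift y)
      (s *: delta_mx 0 j) - h (rV_cons (t, y)))) =
    (fun s => s^-1 *: ((h \o shift (rV_cons (t, y)))
      (s *: delta_mx 0 (lift ord0 j)) - h (rV_cons (t, y)))) by [].
by apply/funext => s /=; rewrite rV_cons_shift_r.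
Qed.

Lemma partial_vanishes_off_box (R : realType) (n : nat) (M : R) (k : 'I_n)
    (h : 'rV[R]_n -> R) :
  vanishes_off_box M h -> vanishes_off_box M (partial k h).
Proof.
move=> hM x i Mx; rewrite /partial (@near_eq_derive _ _ _ h (cst 0)) ?derive_cst//.
have : \forall y \near x, M < `|(y : 'rV[R]_n) 0 i|.
  have : {for x, continuous (fun y : 'rV[R]_n => `|y 0 i|)}.
    by apply: continuous_comp; [exact: coord_continuous|exact: norm_continuous].
  by move=> /cvgr_gt; exact.
by apply: filterS => y; exact: hM.
Qed.

(** * The integral of a partial derivative *)

(** Fubini's theorem in both orders, through the definition of the measure on
    R^(n+1) as the image of a product measure under [rV_cons]. *)
Lemma integral_rV_cons (R : realType) (n : nat) (g : 'rV[R]_n.+1 -> \bar R) :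
  (lebesgue_rV R n.+1).-integrable setT g ->
  (\int[lebesgue_rV R n.+1]_x g x =
     \int[@lebesgue_measure R]_t \int[lebesgue_rV R n]_y g (rV_cons (t, y)))%E /\
  (\int[lebesgue_rV R n.+1]_x g x =
     \int[lebesgue_rV R n]_y \int[@lebesgue_measure R]_t g (rV_cons (t, y)))%E.
Proof.
move=> ig; have mg : measurable_fun setT g := measurable_int _ ig.
have mcons := @measurable_rV_cons R n.
pose mu := (@lebesgue_measure R \x lebesgue_rV R n)%E.
have ig' : mu.-integrable setT (g \o @rV_cons R n).
  apply/integrableP; split; first exact: measurableT_comp.
  move/integrableP : ig => [_]; rewrite [X in (X < _)%E -> _]/=.
  rewrite /lebesgue_rV_step ge0_integral_pushforward//.
  exact: measurableT_comp.
have -> : (\int[lebesgue_rV R n.+1]_x g x = \int[mu]_p (g \o @rV_cons R n) p)%E.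
  by rewrite /= /lebesgue_rV_step integral_pushforward.
by split; [rewrite -integral12_prod_meas1|rewrite -integral21_prod_meas1].
Qed.

(** Fundamental theorem of calculus on a segment whose endpoints are already
    outside the support. *)
Lemma integral_derive1_eq0 (R : realType) (M : R) (h h' : R -> R) :
  (forall t, derivable h t 1) -> (forall t, 'D_1 h t = h' t) -> continuous h' ->
  (forall t, M < `|t| -> h t = 0) -> (forall t, M < `|t| -> h' t = 0) ->
  (\int[lebesgue_measure]_t (h' t)%:E = 0)%E.
Proof.
move=> dh hh' ch' hM h'M.
(* M may be negative; N is positive and lies beyond M. *)
pose N := `|M| + 1.
have MN t : N <= `|t| -> M < `|t|.
  by apply: lt_le_trans; rewrite (le_lt_trans (ler_norm M))// ltrDl.
have N0 : 0 < N by rewrite ltr_wpDl.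
have ch : continuous h by move=> t; exact/differentiable_continuous/derivable1_diffP.
have -> : (\int[lebesgue_measure]_t (h' t)%:E =
    \int[lebesgue_measure]_(t in `[(- N)%R, N]) (h' t)%:E)%E.
  rewrite [RHS]integral_mkcond; apply: eq_integral => t _.
  rewrite patchE; case: ifPn => // /negP tN; rewrite h'M//; apply: MN.
  have /negP : ~ (t \in `[(- N), N]) by move=> ?; apply: tN; rewrite inE.
  by rewrite in_itv/= -ler_norml -ltNge => /ltW.
rewrite (@continuous_FTC2 _ _ h).
- by rewrite !hM ?subee//; apply: MN; rewrite ?normrN ger0_norm// ltW.
- by rewrite gtrN.
- exact: continuous_subspaceT.
- split => [t _||]; first exact: dh.
  + exact/cvg_at_right_filter/ch.
  + exact/cvg_at_left_filter/ch.
- by move=> t _; rewrite derive1E hh'.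
Qed.

(** By induction on [n]. When [k] is the first coordinate the inner integral runs
    over that coordinate and vanishes by [integral_derive1_eq0]; otherwise it runs
    over the other coordinates and vanishes by the induction hypothesis for the
    slice. *)
Lemma integral_partial_eq0 (R : realType) (n : nat) (M : R) (k : 'I_n)
    (h : 'rV[R]_n -> R) :
  vanishes_off_box M h ->
  (forall x, derivable h x (delta_mx 0 k)) -> continuous (partial k h) ->
  (\int[lebesgue_rV R n]_x (partial k h x)%:E = 0)%E.
Proof.
elim: n k h => [[]//|n IH] k h hM dh ch.
have h'M := partial_vanishes_off_box k hM.
have [int1 int2] := integral_rV_cons (integrable_vanishes_off_box ch h'M).
case: (unliftP ord0 k) => [j ->|->] in dh ch h'M int1 int2 *.
- rewrite int1 integral0_eq// => t _.
  under eq_integral => y _ do rewrite /= -(derivable_rV_cons_r h j t y).2.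
  apply: IH.
  + by move=> y i Mi; apply: (hM _ (lift ord0 i)); rewrite rV_consS.
  + by move=> y; apply/(derivable_rV_cons_r h j t y).1.
  + rewrite (_ : partial _ _ = partial (lift ord0 j) h \o (fun y => rV_cons (t, y))).
      by move=> y; apply: continuous_comp; [exact: continuous_rV_cons_r|exact: ch].
    by apply/funext => y; exact: (derivable_rV_cons_r h j t y).2.
- rewrite int2 integral0_eq// => y _ /=.
  apply: (@integral_derive1_eq0 _ M (fun t => h (rV_cons (t, y)))).
  + by move=> t; apply/(derivable_rV_cons_l h t y).1.
  + by move=> t; exact: (derivable_rV_cons_l h t y).2.
  + by move=> t; apply: continuous_comp; [exact: continuous_rV_cons_l|exact: ch].
  + by move=> t Mt; apply: (hM _ 0); rewrite rV_cons0.
  + by move=> t Mt; apply: (h'M _ 0); rewrite rV_cons0.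
Qed.

(** * Integration by parts against the position vector *)

Lemma is_derive_coord (R : realType) (n : nat) (k : 'I_n) (x : 'rV[R]_n) :
  is_derive x (delta_mx 0 k) (fun y : 'rV[R]_n => y 0 k) 1.
Proof.
have q : (fun s : R => s^-1 *: (((fun y : 'rV[R]_n => y 0 k) \o shift x)
    (s *: delta_mx 0 k) - x 0 k)) @ 0^' --> (1 : R).
  apply: (@cvg_trans _ ((cst (1 : R)) @ (0 : R)^')); last exact: cvg_cst.
  apply: near_eq_cvg; near=> s.
  rewrite /= !mxE !eqxx mulr1 addrK [_ *: _]mulVf//.
  by near: s; exact: nbhs_dnbhs_neq.
by apply: DeriveDef; [apply/cvg_ex; exists 1|exact: cvg_lim q].
Unshelve. all: by end_near. Qed.

(** The product rule gives d_k (x_k g) = x_k d_k g + g, and the left-hand side has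
    integral 0. *)
Lemma integral_mul_coord_partial (R : realType) (n : nat) (M : R) (k : 'I_n)
    (g : 'rV[R]_n -> R) :
  vanishes_off_box M g -> continuous g ->
  (forall x, derivable g x (delta_mx 0 k)) -> continuous (partial k g) ->
  (\int[lebesgue_rV R n]_x (- (x 0 k * partial k g x))%:E =
   \int[lebesgue_rV R n]_x (g x)%:E)%E.
Proof.
move=> gM cg dg cdg.
pose h : 'rV[R]_n -> R := (fun x : 'rV[R]_n => x 0 k) * g.
have hM : vanishes_off_box M h by move=> x i Mx; rewrite /h fctE (gM x i)// mulr0.
have dcoord x := @is_derive_coord R n k x.
have ddcoord x : derivable (fun y : 'rV[R]_n => y 0 k) x (delta_mx 0 k).
  by case: (dcoord x).
have dh x : derivable h x (delta_mx 0 k).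
  exact: derivableM.
have dhE : partial k h = (fun x : 'rV[R]_n => x 0 k * partial k g x + g x).
  apply/funext => x; rewrite /partial /h deriveM//.
  by rewrite (@derive_val _ _ _ _ _ _ _ (dcoord x)) [g x *: _]mulr1.
have ccoord : continuous (fun x : 'rV[R]_n => x 0 k) by exact: coord_continuous.
have cdh : continuous (partial k h).
  by rewrite dhE => x; exact: (cvgD (cvgM (ccoord x) (cdg x)) (cg x)).
have h'M := partial_vanishes_off_box k hM.
transitivity (\int[lebesgue_rV R n]_x ((g x)%:E - (partial k h x)%:E))%E.
  by apply: eq_integral => x _; rewrite dhE -EFinB; congr EFin; ring.
rewrite integralB//=.
- by rewrite (integral_partial_eq0 hM dh cdh) sube0.
- exact: integrable_vanishes_off_box gM.
- exact: integrable_vanishes_off_box h'M.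
Qed.

(** The divergence theorem for the field g(x) x, whose divergence is
    n g + x . grad g: sum of [integral_mul_coord_partial] over the coordinates. *)
Lemma integral_euler (R : realType) (n : nat) (M : R) (g : 'rV[R]_n -> R) :
  vanishes_off_box M g -> continuous g ->
  (forall k x, derivable g x (delta_mx 0 k)) ->
  (forall k, continuous (partial k g)) ->
  (n%:R%:E * \int[lebesgue_rV R n]_x (g x)%:E =
   \int[lebesgue_rV R n]_x (- \sum_k x 0 k * partial k g x)%:E)%E.
Proof.
move=> gM cg dg cdg.
under [RHS]eq_integral do rewrite -sumrN -sumEFin.
rewrite integral_sum//; last first.
  move=> k; apply: (@integrable_vanishes_off_box R n M
    (fun x => - (x 0 k * partial k g x))).
    have ccoord : continuous (fun x : 'rV[R]_n => x 0 k) by exact: coord_continuous.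
    by move=> x; exact: (cvgN (cvgM (ccoord x) (cdg k x))).
  by move=> x i Mx; rewrite (partial_vanishes_off_box k gM Mx) mulr0 oppr0.
under eq_bigr => k _ do rewrite (integral_mul_coord_partial gM cg (dg k) (cdg k)).
have ig := integrable_fin_num measurableT (integrable_vanishes_off_box cg gM).
by rewrite -(fineK ig) sumEFin sumr_const card_ord -EFinM mulr_natl.
Qed.

(** * Pointwise splitting of the gradient *)

Section vector_valued.
Context (R : realType) (n m : nat) (f : 'I_m -> 'rV[R]_n -> R).

Lemma sqr_vnorm x : vnorm f x ^+ 2 = \sum_j f j x ^+ 2.
Proof. by rewrite sqr_sqrtr// sumr_ge0// => j _; exact: sqr_ge0. Qed.

Lemma vnorm_eq0 x : vnorm f x = 0 -> forall j, f j x = 0.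
Proof.
move=> fx0 j; apply/eqP; rewrite -sqrf_eq0.
have : \sum_j f j x ^+ 2 == 0 by rewrite -sqr_vnorm fx0 expr0n.
by rewrite psumr_eq0 => [/allP/(_ j)|i _]; [apply; exact: mem_index_enum|exact: sqr_ge0].
Qed.

Lemma sqr_grad_norm x :
  grad_norm f x ^+ 2 = \sum_k \sum_j partial k (f j) x ^+ 2.
Proof.
rewrite sqr_sqrtr.
  by apply: eq_bigr => k _; apply: eq_bigr => j _; rewrite real_normK// num_real.
by do 2 (apply: sumr_ge0 => ? _); rewrite exprn_ge0.
Qed.

(** Length of the gradient of |f|, because d_k |f| = (f . d_k f) / |f| where f does
    not vanish; division by 0 makes it 0 on the zero set of f, where |f| need not
    be differentiable. *)
Definition grad_vnorm (x : 'rV[R]_n) : R :=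
  Num.sqrt (\sum_k (\sum_j f j x * partial k (f j) x) ^+ 2) / vnorm f x.

Lemma grad_vnorm_ge0 x : 0 <= grad_vnorm x.
Proof. by rewrite divr_ge0// sqrtr_ge0. Qed.

(** Lagrange's identity for f(x) and d_k f(x), summed over k and divided by
    |f(x)|^2; it gives equality wherever f(x) is not 0. *)
Lemma sqr_grad_norm_ge x :
  grad_vnorm x ^+ 2 + (vnorm f x * phase_deriv f x) ^+ 2 <= grad_norm f x ^+ 2.
Proof.
have [fx0|fx0] := eqVneq (vnorm f x) 0.
  by rewrite /grad_vnorm fx0 invr0 mulr0 mul0r !expr0n addr0 sqr_ge0.
have fx20 : vnorm f x ^+ 2 != 0 by rewrite sqrf_eq0.
rewrite le_eqVlt; apply/orP; left; apply/eqP.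
have radial_ge0 : 0 <= \sum_k (\sum_j f j x * partial k (f j) x) ^+ 2.
  by apply: sumr_ge0 => k _; exact: sqr_ge0.
rewrite /grad_vnorm /phase_deriv exprMn (exprMn _ (vnorm f x)).
rewrite (sqr_sqrtr radial_ge0).
rewrite [Num.sqrt (\sum_k \sum_j _) ^+ 2]sqr_sqrtr; last first.
  by do 3 (apply: sumr_ge0 => ? _); exact: sqr_ge0.
apply: (mulfI fx20).
rewrite mulrDr [X in X + _]mulrCA exprVn mulfV// mulr1 mulrA sqr_grad_norm.
rewrite !mulr_sumr -big_split; apply: eq_bigr => k _ /=.
rewrite [X in _ = X * _]sqr_vnorm lagrange_identity; congr (_ + _).
rewrite mulr_sumr; apply: eq_bigr => j _; rewrite mulr_sumr; apply: eq_bigr => l _.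
by field.
Qed.

(** Cauchy-Schwarz in R^n for x and grad (|f|^2) / 2; the factors |f| and 1 / |f| on
    the right cancel where f does not vanish. *)
Lemma norm_euler_le (x : 'rV[R]_n) :
  `|\sum_k x 0 k * \sum_j f j x * partial k (f j) x| <=
  enorm x * vnorm f x * grad_vnorm x.
Proof.
have [fx0|fx0] := eqVneq (vnorm f x) 0.
  rewrite fx0 mulr0 mul0r big1 ?normr0// => k _.
  by rewrite big1 ?mulr0// => j _; rewrite (vnorm_eq0 fx0) mul0r.
rewrite /grad_vnorm mulrA -[X in _ <= X]mulrA mulrAC.
rewrite -mulrA [X in _ <= _ * X](_ : _ =
    Num.sqrt (\sum_k (\sum_j f j x * partial k (f j) x) ^+ 2)).
  exact: cauchy_schwarz_sum.
by field.
Qed.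

Hypothesis cf : forall j, continuous (f j).
Hypothesis cdf : forall j k, continuous (partial k (f j)).
Local Notation RB := (measurableTypeR R).

Let mf j : measurable_fun setT (f j : _ -> RB).
Proof. exact: continuous_measurable_rV. Qed.

Let mdf j k : measurable_fun setT (partial k (f j) : _ -> RB).
Proof. exact: continuous_measurable_rV. Qed.

Let measurable_sqrt d (T : measurableType d) (g : T -> R) :
  measurable_fun setT g -> measurable_fun setT (fun x => Num.sqrt (g x)).
Proof.
exact: (measurableT_comp (continuous_measurable_fun (@sqrt_continuous R))).
Qed.

Lemma measurable_vnorm : measurable_fun setT (vnorm f : _ -> RB).
Proof.
by apply: measurable_sqrt; apply: measurable_sum => j; apply: measurable_funX; exact: mf.
Qed.

Let measurable_invX (i : nat) : measurable_fun setT (fun x => (vnorm f x ^+ i)^-1 : RB).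
Proof.
(* On nonnegative numbers, 0 included, inversion is the real power -1, which is
   measurable on the whole line. *)
under eq_fun do rewrite -powR_inv1 ?exprn_ge0 ?sqrtr_ge0//.
apply: (measurableT_comp (measurable_powR _)).
by apply: measurable_funX; exact: measurable_vnorm.
Qed.

Lemma measurable_grad_vnorm : measurable_fun setT (grad_vnorm : _ -> RB).
Proof.
apply: measurable_funM; last exact: (measurable_invX 1).
apply: measurable_sqrt; apply: measurable_sum => k; apply: measurable_funX.
apply: measurable_sum => j; apply: measurable_funM; [exact: mf|exact: mdf].
Qed.

Lemma measurable_phase_deriv : measurable_fun setT (phase_deriv f : _ -> RB).
Proof.
apply: measurable_sqrt; apply: measurable_sum => k; apply: measurable_sum => j.
(* Filtering the list of indices by j < l makes the sum unconditional, as in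
   [measurable_sum]. *)
rewrite (_ : (fun _ => _) = (fun x => \sum_(l <- enum 'I_m | (j < l)%N)
  (f l x / vnorm f x ^+ 2 * partial k (f j) x
     - f j x / vnorm f x ^+ 2 * partial k (f l) x) ^+ 2)); last first.
  by apply/funext => x; rewrite big_enum_cond.
under eq_fun do rewrite -big_filter.
apply: measurable_sum => l; apply: measurable_funX; apply: measurable_funB;
  apply: measurable_funM (mdf _ _); apply: measurable_funM (mf _) _;
  exact: (measurable_invX 2).
Qed.

End vector_valued.

Lemma measurable_enorm (R : realType) (n : nat) :
  measurable_fun setT (@enorm R n : _ -> measurableTypeR R).
Proof.
have := @measurable_vnorm R n n (fun i x => x 0 i).
by apply => i; exact: coord_continuous.
Qed.

(** * The uncertainty inequality *)

Lemma common_vanishing_box (R : realType) (n m : nat)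
    (f : 'I_m -> 'rV[R]_n -> R) :
  (forall j, compact (supp (f j))) -> exists M, forall j, vanishes_off_box M (f j).
Proof.
move=> cf; have [M fM] := choice (fun j => supp_vanishes_off_box (cf j)).
exists (\sum_j `|M j|) => j x i Mx; apply: (fM j x i); apply: le_lt_trans Mx.
by rewrite (bigD1 j)//= (le_trans (ler_norm _))// lerDl sumr_ge0.
Qed.

(** The Heisenberg half of the theorem: [integral_euler] for g = |f|^2, with
    |x . grad g| <= 2 |x| |f| |grad |f|| by [norm_euler_le]. *)
Lemma integral_radial_ge (R : realType) (n m : nat) (f : 'I_m -> 'rV[R]_n -> R) :
  (forall j, compact (supp (f j))) -> (forall j, continuous (f j)) ->
  (forall j k x, derivable (f j) x (delta_mx 0 k)) ->
  (forall j k, continuous (partial k (f j))) ->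
  ((n%:R / 2)%:E * \int[lebesgue_rV R n]_x (vnorm f x ^+ 2)%:E <=
   \int[lebesgue_rV R n]_x (enorm x * vnorm f x * grad_vnorm f x)%:E)%E.
Proof.
move=> sf cf df cdf; have [M fM] := common_vanishing_box sf.
(* Products in place of squares: the product rule then applies as it stands. *)
pose g : 'rV[R]_n -> R := \sum_j f j * f j.
have gE x : g x = vnorm f x ^+ 2.
  by rewrite sqr_vnorm /g fct_sumE; apply: eq_bigr => j _; rewrite expr2.
have gM : vanishes_off_box M g.
  move=> x i Mx; rewrite /g fct_sumE big1// => j _.
  have -> : (f j * f j) x = f j x * f j x by [].
  by rewrite (fM j x i Mx) mulr0.
have cg : continuous g.
  rewrite /g fct_sumE; apply: continuous_big => [|j _]; first exact: add_continuous.
  by move=> x; exact: (cvgM (cf j x) (cf j x)).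
have dg k x : derivable g x (delta_mx 0 k).
  by apply: derivable_sum => j; apply: derivableM.
have dgE k : partial k g = fun x => (\sum_j f j x * partial k (f j) x) *+ 2.
  apply/funext => x; rewrite /partial derive_sum; last by move=> j; exact: derivableM.
  by rewrite -sumrMnl; apply: eq_bigr => j _; rewrite deriveM.
have cdg k : continuous (partial k g).
  rewrite dgE => x; under eq_fun do rewrite mulr2n.
  have c : continuous (fun y => \sum_j f j y * partial k (f j) y).
    apply: continuous_big => [|j _]; first exact: add_continuous.
    by move=> y; exact: (cvgM (cf j y) (cdf j k y)).
  exact: (cvgD (c x) (c x)).
have mE : measurable_fun setT
    (fun x => enorm x * vnorm f x * grad_vnorm f x : measurableTypeR R).
  apply: measurable_funM; last by apply: measurable_grad_vnorm; [exact: cf|exact: cdf].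
  apply: measurable_funM; first exact: measurable_enorm.
  by apply: measurable_vnorm; exact: cf.
have mdiv : measurable_fun setT
    (fun x : 'rV[R]_n => - \sum_k x 0 k * partial k g x : measurableTypeR R).
  apply: measurableT_comp => //; apply: measurable_sum => k; apply: measurable_funM.
    exact: measurable_coord_rV.
  by apply: continuous_measurable_rV; exact: cdg.
have E0 x : 0 <= enorm x * vnorm f x * grad_vnorm f x.
  by rewrite mulr_ge0 ?grad_vnorm_ge0// mulr_ge0// sqrtr_ge0.
have main : (n%:R%:E * \int[lebesgue_rV R n]_x (g x)%:E <=
    2%:E * \int[lebesgue_rV R n]_x (enorm x * vnorm f x * grad_vnorm f x)%:E)%E.
  rewrite (integral_euler gM cg dg cdg) (le_trans (lee_abs _))//.
  apply: le_trans (le_abse_integral _ _ _) _ => //; first exact/measurable_EFinP.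
  rewrite -ge0_integralZl//; [|exact/measurable_EFinP|by move=> x _; rewrite lee_fin].
  apply: ge0_le_integral => //.
  - by apply: measurableT_comp => //; exact/measurable_EFinP.
  - by apply: measurable_funeM; exact/measurable_EFinP.
  - move=> x _ /=; rewrite normrN -EFinM lee_fin.
    under eq_bigr do rewrite dgE mulrnAr.
    by rewrite sumrMnl normrMn -[leLHS]mulr_natl ler_pM2l// norm_euler_le.
under eq_integral do rewrite -gE.
rewrite mulrC EFinM -muleA lee_pdivrMl//.
Qed.

Theorem theorem1p5 (R : realType) (n m : nat) (f : 'I_m -> 'rV[R]_n -> R)
    (hf : forall j : 'I_m, smooth_compact_supp (f j)) :
  ((\int[lebesgue_rV R n]_x (grad_norm f x ^+ 2)%:E)
     * (\int[lebesgue_rV R n]_x (enorm x ^+ 2 * vnorm f x ^+ 2)%:E)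
   >= (n%:R ^+ 2 / 4)%:E * (\int[lebesgue_rV R n]_x (vnorm f x ^+ 2)%:E) ^+ 2
      + COV f ^+ 2)%E.
Proof.
have cf j : continuous (f j) by exact: ((hf j).1 [::]).1.
have df j k x : derivable (f j) x (delta_mx 0 k) by exact: ((hf j).1 [::]).2.
have cdf j k : continuous (partial k (f j)) by exact: ((hf j).1 [:: k]).1.
have sf j : compact (supp (f j)) by exact: (hf j).2.
(* B is the phase part of the gradient and A * B the integrand of COV. *)
pose A x := enorm x * vnorm f x; pose B x := vnorm f x * phase_deriv f x.
have A0 x : 0 <= A x by rewrite mulr_ge0 ?sqrtr_ge0.
have B0 x : 0 <= B x by rewrite mulr_ge0 ?sqrtr_ge0.
have mA : measurable_fun setT (A : _ -> measurableTypeR R).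
  apply: measurable_funM; first exact: measurable_enorm.
  by apply: measurable_vnorm; exact: cf.
have mB : measurable_fun setT (B : _ -> measurableTypeR R).
  apply: measurable_funM; first by apply: measurable_vnorm; exact: cf.
  by apply: measurable_phase_deriv; [exact: cf|exact: cdf].
have mG : measurable_fun setT (grad_vnorm f : _ -> measurableTypeR R).
  by apply: measurable_grad_vnorm; [exact: cf|exact: cdf].
have mgrad : measurable_fun setT
    (fun x => grad_norm f x ^+ 2 : measurableTypeR R).
  under eq_fun do rewrite sqr_grad_norm.
  apply: measurable_sum => k; apply: measurable_sum => j; apply: measurable_funX.
  by apply: continuous_measurable_rV; exact: cdf.
have AE : (\int[lebesgue_rV R n]_x (enorm x ^+ 2 * vnorm f x ^+ 2)%:E =
    \int[lebesgue_rV R n]_x (A x ^+ 2)%:E)%E.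
  by apply: eq_integral => x _; rewrite exprMn.
have COVE : (COV f = \int[lebesgue_rV R n]_x (A x * B x)%:E)%E.
  by apply: eq_integral => x _; congr EFin; rewrite /A /B; ring.
have sqr_ge0_int (h : 'rV[R]_n -> R) :
    (0 <= \int[lebesgue_rV R n]_x (h x ^+ 2)%:E)%E.
  by apply: integral_ge0 => x _; rewrite lee_fin sqr_ge0.
have grad_split : (\int[lebesgue_rV R n]_x (grad_vnorm f x ^+ 2)%:E +
    \int[lebesgue_rV R n]_x (B x ^+ 2)%:E <=
    \int[lebesgue_rV R n]_x (grad_norm f x ^+ 2)%:E)%E.
  have mG2 : measurable_fun setT (EFin \o (fun x => grad_vnorm f x ^+ 2)).
    by apply/measurable_EFinP; exact: measurable_funX.
  have mB2 : measurable_fun setT (EFin \o (fun x => B x ^+ 2)).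
    by apply/measurable_EFinP; exact: measurable_funX.
  rewrite -ge0_integralD//; [|by move=> x _; rewrite lee_fin sqr_ge0..].
  apply: ge0_le_integral => //.
  - by move=> x _; rewrite adde_ge0// lee_fin sqr_ge0.
  - exact: emeasurable_funD.
  - exact/measurable_EFinP.
  - by move=> x _; rewrite -EFinD lee_fin sqr_grad_norm_ge.
have radial : ((n%:R ^+ 2 / 4)%:E *
      (\int[lebesgue_rV R n]_x (vnorm f x ^+ 2)%:E) ^+ 2 <=
    (\int[lebesgue_rV R n]_x (A x * grad_vnorm f x)%:E) ^+ 2)%E.
  have -> : n%:R ^+ 2 / 4 = (n%:R / 2) * (n%:R / 2) :> R by field.
  rewrite !expe2 EFinM muleACA.
  have n2 : (0 <= (n%:R / 2 : R)%:E)%E by rewrite lee_fin divr_ge0.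
  by apply: lee_pmul; rewrite ?mule_ge0//; exact: integral_radial_ge.
rewrite AE COVE [leRHS]muleC; apply: le_trans (lee_wpmul2l (sqr_ge0_int A) grad_split).
rewrite ge0_muleDr//; apply: leeD; last exact: ge0_integral_cauchy_schwarz.
apply: le_trans radial _; apply: ge0_integral_cauchy_schwarz => // x.
exact: grad_vnorm_ge0.
Qed.
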